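(* Let $(Y,w)$ be a positive weighted subset of a union of two shells $X_{r_1}\cup X_{r_2}$ (with $r_1\ne r_2$) in $H(n,2)$. Let $Y_{r_\nu}=Y\cap X_{r_\nu}$ and assume that $w(y)=w_{r_\nu}$ for any $y\in Y_{r_\nu}$, for $\nu=1,2$. Let $\mathcal B_{r_\nu}=\{B_y: y\in Y_{r_\nu}\}$ be the set of blocks corresponding to $Y_{r_\nu}$ and let $N_{r_\nu}=|Y_{r_\nu}|$ for $\nu=1,2$. Then $(Y,w)$ is a relative $t$-design of $H(n,2)$ (with respect to $u_0$) if and only if $(V,\mathcal B_{r_\nu})$ is a combinatorial $(t-1)$-$(n,r_\nu,\lambda^{(r_\nu)}_{t-1})$ design for $\nu=1,2$ and the equality $$\sum_{\nu=1}^2 w_{r_\nu}\lambda^{(r_\nu)}_t(i_1,\dots,i_t)=\sum_{\nu=1}^2 N_{r_\nu}w_{r_\nu}\prod_{j=0}^{t-1}\frac{r_\nu-j}{n-j}$$ holds for any distinct $t$ points $i_1,\dots,i_t$ in $V$, where $\lambda^{(r_\nu)}_t(i_1,\dots,i_t)$ denotes the number of blocks in $\mathcal B_{r_\nu}$ containing $\{i_1,\dots,i_t\}$.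
   Context: Let $V=\{1,\dots,n\}$, let $X=\{0,1\}^n$ be the point set of the binary Hamming scheme $H(n,2)$, $u_0=(0,\dots,0)$, and let the shell $X_r$ be the set of vectors in $X$ with exactly $r$ ones. For $x\in X$ put $B_x=\{i\in V: x_i=1\}$. A positive weighted subset $(Y,w)$ is a subset $Y\subset X$ with $w:Y\to\mathbb R_{>0}$. If $Y\subset X_{r_1}\cup\dots\cup X_{r_p}$ with distinct $r_\nu$, put $Y_{r_\nu}=Y\cap X_{r_\nu}$ and $w(Y_{r_\nu})=\sum_{y\in Y_{r_\nu}}w(y)$; then $(Y,w)$ is a relative $t$-design with respect to $u_0$ if for every $1\le j\le t$ and every $z\in X_j$ $$\sum_{\nu=1}^p\frac{w(Y_{r_\nu})}{|X_{r_\nu}|}\sum_{x\in X_{r_\nu}}f_z(x)=\sum_{y\in Y}w(y)f_z(y),$$ where $f_z(x)=1$ if $B_z\subset B_x$ and $f_z(x)=0$ otherwise. (This is the definition via the P-structure; for $H(n,2)$ it coincides with the one via the Q-structure.) A combinatorial $s$-$(n,k,\lambda)$ design is a pair $(V,\mathcal B)$ with $|V|=n$ and $\mathcal B$ a set of $k$-element subsets of $V$ such that every $s$-element subset of $V$ is contained in exactly $\lambda$ blocks.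
   Formalization: The formal theorem assumes 1 ≤ t ≤ n and t-1 ≤ r_ν ≤ n (the usual convention s ≤ k for designs); without t-1 ≤ r_ν the ''if'' part fails, e.g. n=5, t=3, r_1=1, r_2=2, Y a single point of X_1 with weight 1. *)

(* Defs.v *)
From mathcomp Require Import all_boot all_order all_algebra.

Set Implicit Arguments.
Unset Strict Implicit.
Unset Printing Implicit Defensive.

Import Order.TTheory GRing.Theory Num.Theory.
Local Open Scope ring_scope.

(* The points of H(n,2); the coordinate set V = {1, ..., n} is 'I_n. *)
Definition hamming (n : nat) := {ffun 'I_n -> bool}.

(* B_x = {i in V : x_i = 1}. *)
Definition block (n : nat) (x : hamming n) : {set 'I_n} := [set i | x i].

(* X_r, centred at u_0 = (0, ..., 0). *)
Definition shell (n r : nat) : {set hamming n} := [set x | #|block x| == r].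

Definition shell_part (n : nat) (Y : {set hamming n}) (r : nat) :
  {set hamming n} := Y :&: shell n r.

(* f_z(x) = 1 if B_z is contained in B_x, and 0 otherwise. *)
Definition f_incl (R : realFieldType) (n : nat) (z x : hamming n) : R :=
  (block z \subset block x)%:R.

(* A weight on Y is given by a function on all points, of which only the
   values on Y are ever used. *)
Definition weight (R : realFieldType) (n : nat) (w : hamming n -> R)
  (A : {set hamming n}) : R := \sum_(y in A) w y.

Definition positive_weighted_subset (R : realFieldType) (n : nat)
  (Y : {set hamming n}) (w : hamming n -> R) : Prop :=
  forall y, y \in Y -> 0 < w y.

(* Relative t-design with respect to u_0, for Y contained in the union of the
   shells of radii r_0, ..., r_(p-1).  The radii must be distinct: a repeated
   radius would be counted twice on the left-hand side. *)
Definition relative_design (R : realFieldType) (n p : nat) (r : 'I_p -> nat)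
  (t : nat) (Y : {set hamming n}) (w : hamming n -> R) : Prop :=
  [/\ injective r,
      Y \subset \bigcup_(v < p) shell n (r v) &
      forall (j : nat) (z : hamming n), (1 <= j <= t)%N -> z \in shell n j ->
        \sum_(v < p) weight w (shell_part Y (r v)) / #|shell n (r v)|%:R
                     * (\sum_(x in shell n (r v)) f_incl R z x)
        = \sum_(y in Y) w y * f_incl R z y].

Definition blocks (n : nat) (A : {set hamming n}) : {set {set 'I_n}} :=
  [set block y | y in A].

Definition num_containing (V : finType) (B : {set {set V}}) (S : {set V}) :
  nat := #|[set b in B | S \subset b]|.

(* (V, B) is a combinatorial s-(n, k, lambda) design. *)
Definition combinatorial_design (V : finType) (s n k lambda : nat)
  (B : {set {set V}}) : Prop :=
  [/\ #|V| = n,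
      forall b : {set V}, b \in B -> #|b| = k &
      forall S : {set V}, #|S| = s -> num_containing B S = lambda].

(* Main.v *)
(** For a family [B] of [r]-subsets of an [n]-set, let [lambda(S)] be the number
    of members of [B] containing [S].  Counting pairs gives
      [sum_(k notin S) lambda(S + k) = (r - #|S|) * lambda(S)],
    so that constancy of [lambda] at a level [s <= r] propagates to all lower
    levels and forces [lambda(S) = #|B| * prod_(j < #|S|) (r - j) / (n - j)]
    there.  The relative design condition says that the weighted defects
    [e_v(S) = w_v * (lambda_v(S) - N_v * prod_(j < #|S|) (r_v - j) / (n - j))]
    of the two shells cancel for [#|S| <= t].  For [#|S| = t - 1], summing this
    cancellation over the [t]-sets containing [S] gives
    [sum_v (r_v - t + 1) * e_v(S) = 0], which together with [sum_v e_v(S) = 0]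
    and [r_1 <> r_2] forces both defects to vanish. *)
Require Import Defs.
From mathcomp Require Import all_boot all_order all_algebra.
From mathcomp Require Import ring.

Set Implicit Arguments.
Unset Strict Implicit.
Unset Printing Implicit Defensive.

Import Order.TTheory GRing.Theory Num.Theory.
Local Open Scope ring_scope.

(** For [j <= r <= n] this is ['C(n - j, r - j) / 'C(n, r)], the proportion of [r]-subsets of an
    [n]-set that contain a given [j]-set. Subtraction takes place in [R], so the product vanishes
    once [j] exceeds [r]. *)
Definition falling_ratio (R : realFieldType) (r n j : nat) : R :=
  \prod_(i < j) ((r%:R - i%:R) / (n%:R - i%:R)).

Lemma falling_ratioS (R : realFieldType) (r n j : nat) : (j < n)%N ->
  (n%:R - j%:R) * falling_ratio R r n j.+1
  = (r%:R - j%:R) * falling_ratio R r n j.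
Proof.
move=> jn; rewrite /falling_ratio big_ord_recr /=.
have nz : n%:R - j%:R != 0 :> R by rewrite subr_eq0 eqr_nat gtn_eqF.
by rewrite mulrC -mulrA divfK // mulrC.
Qed.

Lemma falling_ratio_eq0 (R : realFieldType) (r n j : nat) : (r < j)%N ->
  falling_ratio R r n j = 0.
Proof.
by move=> rj; rewrite /falling_ratio (bigD1 (Ordinal rj)) //= subrr !mul0r.
Qed.

Section UniformFamily.

Variables (R : realFieldType) (V : finType) (B : {set {set V}}) (r : nat).
Hypothesis B_card : forall b, b \in B -> #|b| = r.

Lemma num_containingE (S : {set V}) :
  (num_containing B S)%:R = \sum_(b in B) (S \subset b)%:R :> R.
Proof.
rewrite /num_containing -sum1_card natr_sum.
rewrite (bigID (fun b : {set V} => S \subset b) (mem B)) /=.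
rewrite [X in _ = _ + X]big1 ?addr0 => [|b /andP[_ /negbTE->] //].
by apply: eq_big => b; rewrite inE // => /andP[_ ->].
Qed.

Lemma num_containing_set0 : num_containing B set0 = #|B|.
Proof. by apply: eq_card => b; rewrite inE sub0set andbT. Qed.

(** Double counting of pairs [(k, b)]: a block containing [S] is met once for each [k] in [b :\: S],
    any other block never. *)
Lemma sum_num_containing_setU1 (S : {set V}) :
  \sum_(k in ~: S) (num_containing B (k |: S))%:R
  = (r%:R - #|S|%:R) * (num_containing B S)%:R :> R.
Proof.
under eq_bigr do rewrite num_containingE.
rewrite exchange_big num_containingE mulr_sumr; apply: eq_bigr => b bB /=.
have [Sb|nSb] := boolP (S \subset b); last first.
  by rewrite mulr0 big1 // => k _; rewrite subUset (negbTE nSb) andbF.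
rewrite mulr1 -(B_card bB) -natrB ?subset_leq_card // -cardsDS //.
rewrite -sum1_card natr_sum (bigID (mem b)) /= [X in _ + X]big1 ?addr0.
  apply: eq_big => [k|k /andP[_ kb]]; first by rewrite !inE.
  by rewrite subUset sub1set kb Sb.
by move=> k /andP[_ /negbTE kb]; rewrite subUset sub1set kb.
Qed.

Lemma num_containing_const (s lambda : nat) : (s <= r)%N ->
    (forall S : {set V}, #|S| = s -> num_containing B S = lambda) ->
  forall S : {set V}, (#|S| <= s)%N ->
    (num_containing B S)%:R = #|B|%:R * falling_ratio R r #|V| #|S|.
Proof.
move=> sr Bs S; move: {2}#|S| (erefl #|S|) => j Sj.
(* Constancy descends from level [s], with [d] the distance already covered. The double count is
   divided by [r - (s - d.+1)], which is nonzero because [s <= r]. *)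
have const d : (d <= s)%N ->
    exists c : R, forall T : {set V}, #|T| = (s - d)%N ->
      (num_containing B T)%:R = c.
  elim: d => [|d IHd] ds.
    by exists lambda%:R => T; rewrite subn0 => /Bs->.
  have [c cE] := IHd (ltnW ds).
  exists ((#|V| - (s - d.+1))%:R * c / (r%:R - (s - d.+1)%:R)) => T Td.
  have nz : r%:R - (s - d.+1)%:R != 0 :> R.
    rewrite subr_eq0 eqr_nat gtn_eqF // (leq_trans _ sr) //.
    by rewrite ltn_subrL (leq_trans _ ds).
  apply: (mulfI nz); rewrite [RHS]mulrC divfK // -Td.
  rewrite -sum_num_containing_setU1.
  rewrite (eq_bigr (fun=> c)) => [|k]; last first.
    by rewrite inE => kT; rewrite cE // cardsU1 kT Td add1n subnSK.
  by rewrite sumr_const cardsCs setCK mulr_natl.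
(* The value is then found by climbing from the empty set, which lies in all [#|B|] blocks. All
   extensions of [S :\ x] by one point have the same count, so the double count at [S :\ x]
   determines the count at [S]. *)
rewrite Sj; elim: j S Sj => [|j IHj] S Sj js.
  move/eqP: Sj; rewrite cards_eq0 => /eqP->.
  by rewrite num_containing_set0 /falling_ratio big_ord0 mulr1.
have [x xS] : exists x, x \in S by apply/card_gt0P; rewrite Sj.
have S'j : #|S :\ x| = j by move: Sj; rewrite (cardsD1 x) xS => -[].
have [c cE] := const (s - j.+1)%N (leq_subr _ _).
rewrite subKn // in cE.
have jV : (j < #|V|)%N by rewrite -Sj max_card.
have nz : #|V|%:R - j%:R != 0 :> R by rewrite subr_eq0 eqr_nat gtn_eqF.
apply: (mulfI nz); rewrite mulrCA falling_ratioS // mulrCA.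
rewrite -(IHj (S :\ x)) ?(ltnW js) // -S'j -sum_num_containing_setU1.
rewrite (eq_bigr (fun=> c)) => [|k]; last first.
  by rewrite inE => kS; rewrite cE // cardsU1 kS S'j.
by rewrite sumr_const [#|~: _|]cardsCs setCK cE // -[RHS]mulr_natl natrB // S'j ltnW.
Qed.

End UniformFamily.

Section Hamming.

Variables (R : realFieldType) (n : nat).
Implicit Types (A Y : {set hamming n}) (S : {set 'I_n}).

Lemma block_inj : injective (@block n).
Proof. by move=> x y /setP xy; apply/ffunP=> i; have := xy i; rewrite !inE. Qed.

Lemma block_finfun S : block [ffun i => i \in S] = S.
Proof. by apply/setP=> i; rewrite inE ffunE. Qed.

Lemma card_blocks A : #|blocks A| = #|A|.
Proof. exact: card_imset block_inj. Qed.

Lemma sum_f_incl A z :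
  \sum_(x in A) f_incl R z x = (num_containing (blocks A) (block z))%:R.
Proof. by rewrite num_containingE big_imset //; apply: in2W; apply: block_inj. Qed.

Lemma card_in_blocks_shell_part Y r b :
  b \in blocks (shell_part Y r) -> #|b| = r.
Proof. by case/imsetP=> x; rewrite !inE => /andP[_ /eqP<-] ->. Qed.

(** The full shell is an [r]-design with [lambda = 1], since an [r]-set is contained in exactly one
    [r]-set, namely itself. This settles [#|S| <= r]; for larger [S] both sides are 0. *)
Lemma num_containing_shell r S : (r <= n)%N ->
  (num_containing (blocks (shell n r)) S)%:R
  = #|shell n r|%:R * falling_ratio R r n #|S|.
Proof.
move=> rn.
have shellE b : (b \in blocks (shell n r)) = (#|b| == r).
  apply/imsetP/idP => [[x] |br]; first by rewrite inE => xr ->.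
  by exists [ffun i => i \in b]; rewrite ?inE block_finfun.
have [Sr|rS] := leqP #|S| r; last first.
  rewrite falling_ratio_eq0 // mulr0 num_containingE big1 // => b.
  rewrite shellE => /eqP br; rewrite (_ : _ \subset _ = false) //.
  by apply: contraTF rS => /subset_leq_card; rewrite br -leqNgt.
rewrite -card_blocks -[in falling_ratio _ _ n](card_ord n).
apply: (@num_containing_const _ _ _ _ _ r 1) => // [b|T Tr].
  by rewrite shellE => /eqP.
rewrite /num_containing -(cards1 T); apply: eq_card => b; rewrite !inE shellE.
apply/idP/eqP => [/andP[/eqP br Tb]|bT].
  by apply/esym/eqP; rewrite eqEcard Tb br Tr leqnn.
by rewrite bT Tr eqxx subxx.
Qed.

Lemma card_shell_gt0 r : (r <= n)%N -> (0 < #|shell n r|)%N.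
Proof.
move=> rn; rewrite -card_blocks.
have : (0 < #|[set b : {set 'I_n} | #|b| == r]|)%N.
  by rewrite card_draws card_ord bin_gt0.
case/card_gt0P=> b; rewrite inE => br; apply/card_gt0P; exists b.
by apply/imsetP; exists [ffun i => i \in b]; rewrite ?inE block_finfun.
Qed.

(** On the left, averaging [f_incl] over a full shell yields [falling_ratio]. On the right, distinct
    radii make the parts of [Y] disjoint, so the sum splits by shell into block counts. *)
Lemma relative_designP (p t : nat) (r : 'I_p -> nat) Y (w : hamming n -> R)
    (wr : 'I_p -> R) :
    (forall v, (r v <= n)%N) -> injective r ->
    Y \subset \bigcup_(v < p) shell n (r v) ->
    (forall v y, y \in shell_part Y (r v) -> w y = wr v) ->
  relative_design r t Y w <->
  forall S, (#|S| <= t)%N ->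
    \sum_(v < p) wr v * (num_containing (blocks (shell_part Y (r v))) S)%:R
    = \sum_(v < p) #|shell_part Y (r v)|%:R * wr v * falling_ratio R (r v) n #|S|.
Proof.
move=> rn r_inj hY hwr.
have YE : Y = \bigcup_(v < p) shell_part Y (r v).
  by rewrite /shell_part -big_distrr /=; apply/esym/setIidPl.
have rhsE z : \sum_(y in Y) w y * f_incl R z y
    = \sum_(v < p) wr v
        * (num_containing (blocks (shell_part Y (r v))) (block z))%:R.
  rewrite {1}YE partition_disjoint_bigcup /=; last first.
    move=> u v uv; rewrite -setI_eq0; apply/eqP/setP=> y; rewrite !inE.
    apply/negP=> /andP[/andP[_ /eqP yu] /andP[_ /eqP yv]].
    by case/eqP: uv; apply: r_inj; rewrite -yu -yv.
  apply: eq_bigr => v _; rewrite -sum_f_incl mulr_sumr.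
  by apply: eq_bigr => y /hwr->.
have lhsE z : \sum_(v < p) weight w (shell_part Y (r v)) / #|shell n (r v)|%:R
                     * (\sum_(x in shell n (r v)) f_incl R z x)
    = \sum_(v < p) #|shell_part Y (r v)|%:R * wr v
        * falling_ratio R (r v) n #|block z|.
  apply: eq_bigr => v _; rewrite sum_f_incl num_containing_shell // mulrA.
  have nz : #|shell n (r v)|%:R != 0 :> R.
    by rewrite pnatr_eq0 -lt0n card_shell_gt0.
  rewrite divfK // /weight (eq_bigr (fun=> wr v)) => [|y /hwr->//].
  by rewrite sumr_const mulr_natl.
split=> [[_ _ H] S St|H].
  (* The definition starts at [j = 1]; for the empty set both sides are the total weight of [Y]. *)
  case: (posnP #|S|) => [S0|S_gt0].
    rewrite S0; move/eqP: S0; rewrite cards_eq0 => /eqP->.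
    apply: eq_bigr => v _; rewrite num_containing_set0 card_blocks.
    by rewrite /falling_ratio big_ord0 mulr1 mulrC.
  have := H #|S| [ffun i => i \in S].
  rewrite lhsE rhsE block_finfun inE block_finfun S_gt0 => H'.
  by rewrite H'.
split=> // j z /andP[_ jt]; rewrite inE => /eqP zj.
by rewrite lhsE rhsE H // zj.
Qed.

End Hamming.

Theorem theorem3p4 (R : realFieldType) (n t : nat) (r : 'I_2 -> nat)
    (Y : {set hamming n}) (w : hamming n -> R) (wr : 'I_2 -> R)
    (ht : (1 <= t <= n)%N)
    (hr : forall v : 'I_2, (t.-1 <= r v <= n)%N)
    (r_inj : injective r)
    (hY : Y \subset \bigcup_(v < 2) shell n (r v))
    (hw : positive_weighted_subset Y w)
    (hwr : forall (v : 'I_2) (y : hamming n),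
        y \in shell_part Y (r v) -> w y = wr v) :
  relative_design r t Y w
  <->
  (forall v : 'I_2, exists lambda : nat,
      combinatorial_design t.-1 n (r v) lambda (blocks (shell_part Y (r v))))
  /\
  (forall i : t.-tuple 'I_n, uniq i ->
     \sum_(v < 2) wr v *
        (num_containing (blocks (shell_part Y (r v)))
                        [set k : 'I_n | k \in tval i])%:R
     = \sum_(v < 2) #|shell_part Y (r v)|%:R * wr v *
         \prod_(j < t) (((r v)%:R - j%:R) / (n%:R - j%:R))).
Proof.
have tn : (t.-1 < n)%N by case/andP: ht => t_gt0; rewrite prednK.
have tE : t = t.-1.+1 by rewrite prednK //; case/andP: ht.
have rn v : (r v <= n)%N by case/andP: (hr v).
pose B v := blocks (shell_part Y (r v)).
have B_card v b : b \in B v -> #|b| = r v.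
  exact: card_in_blocks_shell_part.
have [toD ofD] := relative_designP t rn r_inj hY hwr.
split=> [/toD D|[des eqt]].
  split=> [v|i i_uniq]; last first.
    have it : #|[set k | k \in tval i]| = t.
      by rewrite cardsE (card_uniqP i_uniq) size_tuple.
    by have := D [set k | k \in tval i]; rewrite it; apply.
  have defect0 (S : {set 'I_n}) : #|S| = t.-1 ->
      wr v * (num_containing (B v) S)%:R
      = #|shell_part Y (r v)|%:R * wr v * falling_ratio R (r v) n t.-1.
    move=> St.
    pose e u : R := wr u * (num_containing (B u) S)%:R
      - #|shell_part Y (r u)|%:R * wr u * falling_ratio R (r u) n t.-1.
    have e_sum : \sum_(u < 2) e u = 0.
      by apply/eqP; rewrite big_split sumrN /= subr_eq0 -St D // St leq_pred.
    (* The level [t] relation is summed over the [n - t.-1] one-point extensions of [S]. Double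
       counting on one side and [falling_ratioS] on the other produce the same factor
       [r u - t.-1]. *)
    have re_sum : \sum_(u < 2) ((r u)%:R - t.-1%:R) * e u = 0.
      have : \sum_(k in ~: S)
          (\sum_(u < 2) wr u * (num_containing (B u) (k |: S))%:R)
        = \sum_(k in ~: S) \sum_(u < 2)
            #|shell_part Y (r u)|%:R * wr u * falling_ratio R (r u) n t.
        apply: eq_bigr => k; rewrite inE => kS.
        have kSt : #|k |: S| = t by rewrite cardsU1 kS St add1n -tE.
        by have := D (k |: S); rewrite kSt; apply.
      rewrite exchange_big [RHS]exchange_big /= => /eqP.
      rewrite -subr_eq0 -sumrB => /eqP sum0; rewrite -[RHS]sum0.
      apply: eq_bigr => u _.
      rewrite -mulr_sumr (sum_num_containing_setU1 _ (B_card u)) sumr_const.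
      rewrite [#|~: _|]cardsCs setCK card_ord St -[_ *+ (n - _)]mulr_natl.
      rewrite natrB ?(ltnW tn) // [in falling_ratio _ _ _ t]tE.
      rewrite [X in _ = _ - X]mulrCA falling_ratioS // /e; ring.
    suff /eqP : e v = 0 by rewrite subr_eq0 => /eqP.
    have r_neq : (r ord0)%:R - (r ord_max)%:R != 0 :> R.
      by rewrite subr_eq0 eqr_nat (inj_eq r_inj).
    move: e_sum re_sum; rewrite !big_ord_recl !big_ord0 !addr0.
    rewrite (_ : lift ord0 ord0 = ord_max); last exact: val_inj.
    move=> /eqP; rewrite addr_eq0 => /eqP e0 re0.
    (* Substituting [e ord0 = - e ord_max] leaves the difference of the two radii times
       [e ord_max]. *)
    have e1 : e ord_max = 0.
      apply/eqP; move/eqP: re0; rewrite e0 mulrN addrC -mulrBl mulf_eq0.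
      by rewrite opprB addrA subrK -opprB oppr_eq0 (negbTE r_neq).
    have [->|->] : v = ord0 \/ v = ord_max.
      by case: v => -[|[|//]] lt_v; [left|right]; apply: val_inj.
      by rewrite e0 e1 oppr0.
    exact: e1.
  (* If [Y] misses the shell, [wr v] is unconstrained and cannot be cancelled, but the empty family
     is a design with [lambda = 0]. Otherwise [wr v] is a value of [w] on [Y], hence positive. *)
  have [Yv0|[y yYv]] := set_0Vmem (shell_part Y (r v)).
    exists 0%N; split=> [|b /B_card //|S _]; first exact: card_ord.
    apply/eqP; rewrite cards_eq0 Yv0; apply/eqP/setP=> b.
    by rewrite /blocks imset0 !inE.
  have wrv : wr v != 0.
    by rewrite gt_eqF // -(hwr _ _ yYv) hw //; case/setIP: yYv.
  have [S0 S0t] : exists S : {set 'I_n}, #|S| = t.-1.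
    have : (0 < #|[set S : {set 'I_n} | #|S| == t.-1]|)%N.
      by rewrite card_draws card_ord bin_gt0 ltnW.
    by case/card_gt0P=> S; rewrite inE => /eqP; exists S.
  (* By [defect0] the weighted count depends only on the size [t.-1], so any set of that size gives
     [lambda]. *)
  exists (num_containing (B v) S0).
  split=> [|b /B_card //|S St]; first exact: card_ord.
  apply/eqP; rewrite -(eqr_nat R); apply/eqP/(mulfI wrv).
  by rewrite !defect0.
(* At size [t] the assumed equality applies to an enumeration of [S]. Below [t] the two sides agree
   shell by shell, because each part of [Y] is a design. *)
apply: ofD => S; rewrite leq_eqVlt => /orP[/eqP St|].
  have S_size : size (enum S) == t by rewrite -cardE St.
  have := eqt (Tuple S_size) (enum_uniq _).
  rewrite (_ : [set k | k \in _] = S) ?St //.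
  by apply/setP=> k; rewrite inE mem_enum.
rewrite [in X in X -> _]tE ltnS => St.
apply: eq_bigr => v _; have [lambda [_ _ lE]] := des v.
have tr : (t.-1 <= r v)%N by case/andP: (hr v).
rewrite (num_containing_const R (B_card v) tr lE St) card_ord card_blocks.
by rewrite mulrCA mulrA.
Qed.
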